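(* As full subcategories of the category $\mathsf{SymQnd}$ of symmetric quandles, $\mathsf{AbSymQnd}=\mathsf{Mal}(\mathsf{SymQnd})$. That is, a symmetric quandle $A$ is abelian if and only if it admits the structure of an internal Mal'tsev algebra in $\mathsf{SymQnd}$.
   Context: A quandle is a set $A$ with two binary operations $\lhd, \lhd^{-1}$ such that for all $a,b,c\in A$: $a\lhd a=a=a\lhd^{-1}a$; $(a\lhd b)\lhd^{-1}b=a=(a\lhd^{-1}b)\lhd b$; $(a\lhd b)\lhd c=(a\lhd c)\lhd(b\lhd c)$ and $(a\lhd^{-1} b)\lhd^{-1} c=(a\lhd^{-1} c)\lhd^{-1}(b\lhd^{-1} c)$. Homomorphisms preserve both operations. A quandle is symmetric if $a\lhd b=b\lhd a$ for all $a,b$, and abelian if $(a\lhd b)\lhd(c\lhd d)=(a\lhd c)\lhd(b\lhd d)$ for all $a,b,c,d$. $\mathsf{SymQnd}$ is the variety of symmetric quandles, and $\mathsf{AbSymQnd}$ its full subcategory of symmetric quandles that are abelian. An internal Mal'tsev algebra in a variety $\mathcal{V}$ is an algebra $A\in\mathcal{V}$ together with a homomorphism $p_A\colon A\times A\times A\to A$ in $\mathcal{V}$ such that $p_A(a,a,b)=b$ and $p_A(a,b,b)=a$ for all $a,b\in A$. $\mathsf{Mal}(\mathcal{V})$ denotes the category of internal Mal'tsev algebras in $\mathcal{V}$. Since $\mathsf{SymQnd}$ is a Mal'tsev variety, an internal Mal'tsev operation on a given symmetric quandle is unique when it exists and is preserved by every homomorphism, so $\mathsf{Mal}(\mathsf{SymQnd})$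 is regarded as a full subcategory of $\mathsf{SymQnd}$. *)

(* Defs.v *)
Set Implicit Arguments.
Unset Strict Implicit.

Declare Scope quandle_scope.
Delimit Scope quandle_scope with qnd.
Local Open Scope quandle_scope.

Record quandle : Type := Quandle {
  qcar :> Type;
  qop : qcar -> qcar -> qcar;
  qinv : qcar -> qcar -> qcar;
  qop_idem : forall a, qop a a = a;
  qinv_idem : forall a, qinv a a = a;
  qopK : forall a b, qinv (qop a b) b = a;
  qinvK : forall a b, qop (qinv a b) b = a;
  qop_distr : forall a b c, qop (qop a b) c = qop (qop a c) (qop b c);
  qinv_distr : forall a b c,
    qinv (qinv a b) c = qinv (qinv a c) (qinv b c)
}.

Notation "a <| b" := (qop a b)
  (at level 40, left associativity) : quandle_scope.
Notation "a <|^-1 b" := (qinv a b)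
  (at level 40, left associativity) : quandle_scope.

Definition symmetric_quandle (A : quandle) : Prop :=
  forall a b : A, a <| b = b <| a.

Definition abelian_quandle (A : quandle) : Prop :=
  forall a b c d : A, (a <| b) <| (c <| d) = (a <| c) <| (b <| d).

Record quandle_hom (A B : quandle) : Type := QuandleHom {
  hom_fun :> A -> B;
  hom_op : forall a b, hom_fun (a <| b) = hom_fun a <| hom_fun b;
  hom_inv : forall a b, hom_fun (a <|^-1 b) = hom_fun a <|^-1 hom_fun b
}.

Definition prod_quandle (A B : quandle) : quandle.
Proof.
refine (@Quandle (A * B)
  (fun x y => (fst x <| fst y, snd x <| snd y))
  (fun x y => (fst x <|^-1 fst y, snd x <|^-1 snd y)) _ _ _ _ _ _).
- intros [a b]; simpl; now rewrite !qop_idem.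
- intros [a b]; simpl; now rewrite !qinv_idem.
- intros [a b] [c d]; simpl; now rewrite !qopK.
- intros [a b] [c d]; simpl; now rewrite !qinvK.
- intros [a b] [c d] [e f]; simpl; f_equal; apply qop_distr.
- intros [a b] [c d] [e f]; simpl; f_equal; apply qinv_distr.
Defined.

(* The objects of SymQnd.  The subcategory is full, so its morphisms are the
   quandle homomorphisms between the underlying quandles. *)
Record symquandle : Type := SymQuandle {
  sq_quandle :> quandle;
  sq_sym : symmetric_quandle sq_quandle
}.

Definition prod_symquandle (A B : symquandle) : symquandle.
Proof.
refine (@SymQuandle (prod_quandle A B) _).
intros [a b] [c d]; simpl; f_equal; apply sq_sym.
Defined.

(* An internal Mal'tsev operation on A in SymQnd; the ternary power A x A x A
   is (A x A) x A. *)
Record internal_maltsev (A : symquandle) : Type := InternalMaltsev {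
  maltsev_op : quandle_hom (prod_symquandle (prod_symquandle A A) A) A;
  maltsev_left : forall a b : A, maltsev_op (a, a, b) = b;
  maltsev_right : forall a b : A, maltsev_op (a, b, b) = a
}.

(* Full subcategories of SymQnd are given by their classes of objects. *)
Definition in_AbSymQnd (A : symquandle) : Prop := abelian_quandle A.

Definition in_Mal_SymQnd (A : symquandle) : Prop :=
  inhabited (internal_maltsev A).

(* Main.v *)
(** In a symmetric quandle the term [q a b c = (a <| c) <|^-1 b] satisfies the
    Mal'tsev identities.  If the quandle is abelian, [q] is a homomorphism.
    Conversely an internal Mal'tsev operation commutes with [q], hence equals
    [q]; so [q] preserves [<|], and on triples [(a, e, c)] with a constant
    middle entry this is the abelian law. *)
Require Import Defs.

Set Implicit Arguments.
Unset Strict Implicit.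

Local Open Scope quandle_scope.

Definition maltsev_term (A : quandle) (a b c : A) : A := (a <| c) <|^-1 b.

Lemma qop_cancel_right (A : quandle) (a b c : A) : a <| c = b <| c -> a = b.
Proof.
intros H; now rewrite <- (qopK a c), H, qopK.
Qed.

Lemma qop_inv_distr (A : quandle) (a b c : A) :
  (a <| b) <|^-1 c = (a <|^-1 c) <| (b <|^-1 c).
Proof.
apply (qop_cancel_right (c := c)); now rewrite qop_distr, !qinvK.
Qed.

(** Right translations are injective, so being a homomorphism need only be checked on [<|]. *)
Lemma qop_hom_inv (A B : quandle) (f : A -> B) :
  (forall a b, f (a <| b) = f a <| f b) ->
  forall a b, f (a <|^-1 b) = f a <|^-1 f b.
Proof.
intros Hf a b; apply (qop_cancel_right (c := f b)).
now rewrite <- Hf, !qinvK.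
Qed.

Lemma maltsev_term_left (A : quandle) (a b : A) :
  symmetric_quandle A -> maltsev_term a a b = b.
Proof.
intros sA; unfold maltsev_term; now rewrite (sA a b), qopK.
Qed.

Lemma maltsev_term_right (A : quandle) (a b : A) : maltsev_term a b b = a.
Proof.
apply qopK.
Qed.

(** Translating both sides by [b <| b'] removes the divisions: the abelian law pairs each one with
    its own divisor. *)
Lemma maltsev_term_op (A : quandle) (a b c a' b' c' : A) :
  abelian_quandle A ->
  maltsev_term (a <| a') (b <| b') (c <| c') =
  maltsev_term a b c <| maltsev_term a' b' c'.
Proof.
intros abA; unfold maltsev_term.
apply (qop_cancel_right (c := b <| b')).
rewrite (abA ((a <| c) <|^-1 b)), !qinvK; apply abA.
Qed.

Lemma maltsev_of_abelian (A : symquandle) :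
  abelian_quandle A -> internal_maltsev A.
Proof.
intros abA.
pose (f := fun x : prod_symquandle (prod_symquandle A A) A =>
  maltsev_term (fst (fst x)) (snd (fst x)) (snd x)).
assert (fM : forall x y, f (x <| y) = f x <| f y).
{ intros [[a b] c] [[a' b'] c']; now apply maltsev_term_op. }
apply (@InternalMaltsev A (QuandleHom fM (qop_hom_inv fM))).
- intros a b; apply maltsev_term_left, sq_sym.
- intros a b; apply maltsev_term_right.
Defined.

Lemma internal_maltsevE (A : symquandle) (p : internal_maltsev A) (a b c : A) :
  maltsev_op p (a, b, c) = maltsev_term a b c.
Proof.
(* Interchange [p] and [q] on the columns [(a,b,b)], [(b,b,b)], [(b,b,c)]. *)
assert (E : (a, b, c) = maltsev_term
  (A := prod_symquandle (prod_symquandle A A) A)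
  (a, b, b) (b, b, b) (b, b, c)).
{ unfold maltsev_term; simpl.
  now rewrite qopK, (sq_sym b c), qop_idem, qinv_idem, qopK. }
(* By the Mal'tsev identities [p] sends the three columns to [a], [b] and [c]. *)
rewrite E; unfold maltsev_term.
now rewrite hom_inv, hom_op, !maltsev_right, maltsev_left.
Qed.

Lemma abelian_of_maltsev (A : symquandle) :
  internal_maltsev A -> abelian_quandle A.
Proof.
intros p a b c d.
assert (H : maltsev_op p (a <| b, a <| a, c <| d) =
            maltsev_op p (a, a, c) <| maltsev_op p (b, a, d)).
{ exact (hom_op (maltsev_op p) (a, a, c) (b, a, d)). }
rewrite !internal_maltsevE in H; unfold maltsev_term in H.
(* Since [a <| a] is [a], both sides become quotients by the same [a], which translation by [a] then
   undoes. *)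
rewrite qop_idem, <- qop_inv_distr in H.
now rewrite <- (qinvK ((a <| b) <| (c <| d)) a), H, qinvK.
Qed.

Theorem theorem2p4 (A : symquandle) : in_AbSymQnd A <-> in_Mal_SymQnd A.
Proof.
split.
- intros abA; exact (inhabits (maltsev_of_abelian abA)).
- intros [p]; exact (abelian_of_maltsev p).
Qed.
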